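(* Let $n\mid(q-1)$, let $\delta\ge2$, $b\ge1$, $s\ge1$, $m\ge1$ be integers with $\gcd(b,n)=1$, and let $t\in\{0,1,\dots,n-1\}$. Let $i_1<i_2<\dots<i_s$ be integers with $m-1+\delta\le i_1$, $i_s\le n-\delta$ and $i_{\ell+1}-i_\ell\ge\delta$ for $\ell=1,\dots,s-1$. Put $$A=\{\alpha^{t},\alpha^{t+b},\dots,\alpha^{t+(m-1)b},\alpha^{t+i_1b},\alpha^{t+i_2b},\dots,\alpha^{t+i_sb}\},\qquad B=\{1,\alpha^{b},\alpha^{2b},\dots,\alpha^{(\delta-2)b}\}.$$ Let $d_A^{\perp}$ be the minimum distance of the dual of $C_A$. Then $C_{AB}$ is a cyclic $(d_A^{\perp}-\delta+1,\delta)$-LRC of length $n$ over $\mathbb{F}_q$ with dimension $k=n-m+1-(s+1)(\delta-1)$. Moreover, if $\lceil k/r\rceil=s+1$ where $r=d_A^{\perp}-\delta+1$, then $C_{AB}$ is an optimal $(r,\delta)$-LRC with minimum distance $m+\delta-1$.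
   Context: Let $q$ be a prime power and $n\mid(q-1)$, so the set $R_n$ of all $n$-th roots of unity lies in $\mathbb{F}_q$; let $\alpha\in\mathbb{F}_q$ be a primitive $n$-th root of unity. For $A,B\subseteq R_n$, $AB=\{\beta\gamma:\beta\in A,\gamma\in B\}$, and for $Z\subseteq R_n$, $C_Z$ denotes the cyclic code of length $n$ over $\mathbb{F}_q$ with complete defining set $Z$, i.e. the ideal generated by $\prod_{\beta\in Z}(x-\beta)$ in $\mathbb{F}_q[x]/(x^n-1)$, identified with a subspace of $\mathbb{F}_q^n$; it has dimension $n-|Z|$. Locality: for a linear code $C\subseteq\mathbb{F}_q^n$ and integers $r\ge1$, $\delta\ge2$, the $i$-th coordinate has $(r,\delta)$-locality if there is $S_i\subseteq\{1,\dots,n\}$ with $i\in S_i$, $|S_i|\le r+\delta-1$ such that the punctured code $C|_{S_i}$ has minimum distance at least $\delta$; $C$ is an $(r,\delta)$-LRC if every coordinate has $(r,\delta)$-locality. An $[n,k,d]$ $(r,\delta)$-LRC is optimal if $d=n-k-(\lceil k/r\rceil-1)(\delta-1)+1$ (this quantity is always an upper bound on $d$). *)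

(* Defs.v *)
From HB Require Import structures.
From mathcomp Require Import all_boot all_order all_algebra all_field.
Set Implicit Arguments. Unset Strict Implicit. Unset Printing Implicit Defensive.
Import GRing.Theory Num.Theory.
Local Open Scope ring_scope.

Section Codes.
Variables (F : finFieldType) (n : nat).

Definition wt (c : 'rV[F]_n) : nat := #|[set i : 'I_n | c 0 i != 0]|.

(* minimum distance of a linear code given by its membership predicate;
   convention: the zero code has minimum distance n+1 *)
Definition mindist (P : pred 'rV[F]_n) : nat :=
  \big[minn/n.+1]_(c | P c && (c != 0)) wt c.

Definition dual_code (C : {vspace 'rV[F]_n}) : pred 'rV[F]_n :=
  [pred x | [forall c, (c \in C) ==> (x *m c^T == 0)]].

Definition wt_on (S : {set 'I_n}) (c : 'rV[F]_n) : nat :=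
  #|[set i in S | c 0 i != 0]|.

(* minimum distance of the punctured code C|_S (codewords of C|_S are the
   restrictions to S of codewords of C); zero code: #|S|+1 *)
Definition punct_mindist (C : {vspace 'rV[F]_n}) (S : {set 'I_n}) : nat :=
  \big[minn/#|S|.+1]_(c | (c \in C) && (wt_on S c != 0%N)) wt_on S c.

Definition has_locality (C : {vspace 'rV[F]_n}) (r delta : nat) (i : 'I_n) :=
  exists S : {set 'I_n},
    [/\ i \in S, (#|S| <= r + delta - 1)%N & (delta <= punct_mindist C S)%N].

Definition is_LRC (C : {vspace 'rV[F]_n}) (r delta : nat) :=
  [/\ (0 < r)%N, (2 <= delta)%N & forall i : 'I_n, has_locality C r delta i].

Definition ceil_div (k r : nat) : nat := ((k + r.-1) %/ r)%N.

Definition optimal_LRC (C : {vspace 'rV[F]_n}) (r delta : nat) :=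
  is_LRC C r delta /\
  (mindist (fun c => c \in C))%:Z =
    n%:Z - (\dim C)%:Z - ((ceil_div (\dim C) r)%:Z - 1) * (delta%:Z - 1) + 1.

Definition cyc_gen (Z : {set F}) : {poly F} := \prod_(z in Z) ('X - z%:P).

(* the cyclic code C_Z: the ideal generated by cyc_gen Z in F[x]/(x^n - 1),
   i.e. the F-span of the residues x^j * g mod (x^n - 1), j < n,
   viewed as coefficient vectors in F^n *)
Definition cyclic_code (Z : {set F}) : {vspace 'rV[F]_n} :=
  <<[seq (poly_rV (('X^j * cyc_gen Z) %% ('X^n - 1)) : 'rV[F]_n) | j <- iota 0 n]>>%VS.

End Codes.

Definition setprod (F : finFieldType) (A B : {set F}) : {set F} :=
  [set x * y | x in A, y in B].

(* Main.v *)
Require Import Defs.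
From HB Require Import structures.
From mathcomp Require Import all_boot all_order all_algebra all_field.
From mathcomp Require Import zify.
Import GRing.Theory Num.Theory.
Local Open Scope ring_scope.

(** Put [beta := alpha ^+ b] and [gamma := alpha ^+ t].  The zeros of [C_AB] are
    the [gamma * beta ^+ e] with [e] in [s + 1] disjoint runs of consecutive
    exponents below [n], which gives the dimension.

    Locality: let [x] be a word of minimum weight in the dual of [C_A].  If [c] is
    in [C_AB] and [w] in [B], then [(c_j w^j)_j] is in [C_A], so
    [sum_j x_j c_j w^j = 0].  Thus [(x_j c_j)_j] has [delta - 1] consecutive zeros,
    and by the BCH argument [c] vanishes on the support of [x] or has weight at
    least [delta] there.  Cyclic shifts of [x] reach every coordinate.  The dual
    of [C_A] has [delta - 1] consecutive zeros, coming from the gap between [i_s]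
    and [n], so the parameter [r] is positive.

    Distance: the first run has length [m + delta - 2], so BCH gives
    [d >= m + delta - 1].  The matching upper bound is the Singleton-like bound for
    [(r, delta)]-LRCs: shorten the code successively on repair groups; each group
    lowers the dimension by at most [r] and makes [delta - 1] coordinates vanish
    for free. *)

(* Test the moments against the polynomial vanishing at all but one node of the
   support: no Vandermonde determinant is needed. *)
Lemma card_support_gt_of_moments (K : idomainType) (I : finType) (x y : I -> K)
    (d : nat) (i0 : I) :
  injective x -> (forall j, (j < d)%N -> \sum_i y i * x i ^+ j = 0) ->
  y i0 != 0 -> (d < #|[set i | y i != 0%R]|)%N.
Proof.
move=> xI my yi0; rewrite ltnNge; apply/negP => leSd.
set S := [set i | _] in leSd.
have i0S : i0 \in S by rewrite inE.
pose p : {poly K} := \prod_(i in S :\ i0) ('X - (x i)%:P).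
have szp : (size p <= d)%N.
  rewrite /p -big_enum size_prod_XsubC -cardE.
  by apply: leq_trans leSd; rewrite (cardsD1 i0 S) i0S add1n.
have sum0 : \sum_i y i * p.[x i] = 0.
  under eq_bigr => i _ do rewrite (horner_coef_wide _ szp) mulr_sumr.
  rewrite exchange_big big1 //= => j _.
  under eq_bigr => i _ do rewrite mulrCA.
  by rewrite -mulr_sumr my ?mulr0.
move: sum0; rewrite (bigD1 i0) //= big1 ?addr0 => [/eqP|i ii0].
  rewrite mulf_eq0 (negPf yi0) /= horner_prod => /eqP/eqP/prodf_eq0 [i].
  by rewrite !inE => /andP[ii0 _]; rewrite hornerXsubC subr_eq0 (inj_eq xI) eq_sym (negPf ii0).
have [->|yi] := eqVneq (y i) 0; first by rewrite mul0r.
rewrite horner_prod (bigD1 i) /= ?hornerXsubC ?subrr ?mul0r ?mulr0 //.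
by rewrite !inE ii0.
Qed.

(** * Cyclic codes: zeros and dimension *)

Section LinearCodes.
Variables (F : finFieldType) (n : nat).
Implicit Types (V W C : {vspace 'rV[F]_n}) (c x : 'rV[F]_n) (Z : {set F}).

(** Each form [v *m w i] has image of dimension at most one, so passing to its kernel costs at most
    one dimension; induct on [#|T|]. *)
Lemma dimv_le_add_card (I : finType) (w : I -> 'cV[F]_n) (T : {set I}) V W :
  (forall v, v \in V -> (forall i, i \in T -> v *m w i = 0) -> v \in W) ->
  (\dim V <= \dim W + #|T|)%N.
Proof.
have [k] := ubnP #|T|; elim: k => // k IHk in T V * => /ltnSE leTk VW.
have [T0|/set0Pn[i iT]] := eqVneq T set0.
  rewrite T0 cards0 addn0 dimvS //; apply/subvP => v /VW; apply => i.
  by rewrite T0 inE.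
pose f : 'Hom('rV[F]_n, 'rV[F]_1) := linfun (mulmxr (w i)).
have fV := limg_ker_dim f V.
have f1 : (\dim (f @: V) <= 1)%N by rewrite (leq_trans (dimvS (subvf _))) // dimvf.
have := IHk (T :\ i) (V :&: lker f)%VS.
rewrite [#|T|](cardsD1 i) iT in leTk *.
move=> /(_ leTk) IH; have {IH} : (\dim (V :&: lker f) <= \dim W + #|T :\ i|)%N.
  apply: IH => v /memv_capP[vV]; rewrite memv_ker lfunE /= => /eqP fv vT.
  apply: VW => // j jT; have [->//|ji] := eqVneq j i.
  by apply: vT; rewrite !inE ji.
by move=> IH; rewrite -fV addnCA [(true + _)%N]addnC leq_add.
Qed.

Lemma horner_rVpoly_sum c z : (rVpoly c).[z] = \sum_(j < n) c 0 j * z ^+ j.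
Proof.
rewrite (@horner_coef_wide _ n) ?size_poly //.
by apply: eq_bigr => j _; rewrite coef_rVpoly_ord.
Qed.

Lemma mulmx_powers_eq0 c z :
  (c *m (\col_j z ^+ (j : 'I_n)) == 0) = ((rVpoly c).[z] == 0).
Proof.
rewrite horner_rVpoly_sum; apply/eqP/eqP => [/matrixP/(_ 0 0)|h].
  by rewrite !mxE => h; rewrite -[RHS]h; apply: eq_bigr => j _; rewrite mxE.
apply/matrixP => a b; rewrite !ord1 !mxE -[RHS]h.
by apply: eq_bigr => j _; rewrite mxE.
Qed.

Lemma modXn1_root (p : {poly F}) z : z ^+ n = 1 -> (p %% ('X^n - 1)).[z] = p.[z].
Proof.
move=> zn; rewrite [in RHS](divp_eq p ('X^n - 1)) !hornerE zn.
by rewrite subrr mulr0 add0r.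
Qed.

(** Reduction modulo ['X^n - 1] preserves values at [n]-th roots of unity, so the generators vanish
    on [Z]. Conversely, [cyc_gen Z] has distinct roots and divides [rVpoly c]; the coefficients of
    the quotient [h] express [c] through the generators. *)
Lemma cyclic_codeP Z c : (forall z, z \in Z -> z ^+ n = 1) -> (0 < n)%N ->
  reflect (forall z, z \in Z -> (rVpoly c).[z] = 0) (c \in cyclic_code n Z).
Proof.
move=> Zn n0; have szXn1 : size ('X^n - 1 : {poly F}) = n.+1 by rewrite size_XnsubC.
apply: (iffP idP) => [cZ z zZ|c0].
  pose f : 'Hom('rV[F]_n, 'rV[F]_1) := linfun (mulmxr (\col_(j < n) z ^+ j)).
  suff : (cyclic_code n Z <= lker f)%VS.
    move=> /subvP/(_ _ cZ); rewrite memv_ker lfunE /= mulmx_powers_eq0.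
    by move/eqP.
  apply/span_subvP => _ /mapP[j _ ->].
  rewrite memv_ker lfunE /= mulmx_powers_eq0 poly_rV_K.
    rewrite modXn1_root ?Zn // hornerM horner_prod (bigD1 z) //=.
    by rewrite hornerXsubC subrr mul0r mulr0.
  by rewrite -ltnS -szXn1 ltn_modp -size_poly_eq0 szXn1.
have /dvdpP[h ch] : cyc_gen Z %| rVpoly c.
  rewrite /cyc_gen -big_enum; apply: uniq_roots_dvdp; last by rewrite uniq_rootsE enum_uniq.
  by apply/allP => z; rewrite mem_enum => /c0/eqP.
have szh : (size h <= n)%N.
  have [->|h0] := eqVneq h 0; first by rewrite size_poly0.
  have g0 : cyc_gen Z != 0 by apply/prodf_neq0 => z _; rewrite polyXsubC_eq0.
  have szc : (size (rVpoly c) <= n)%N by exact: size_poly.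
  rewrite ch size_mul // in szc.
  rewrite -size_poly_gt0 in g0; case: (size (cyc_gen Z)) g0 szc => // a _.
  by rewrite addnS; apply: leq_trans; rewrite leq_addr.
have -> : c = \sum_(j < n) h`_j *: (poly_rV (('X^j * cyc_gen Z) %% ('X^n - 1)) : 'rV[F]_n).
  have {1}-> : c = poly_rV ((h * cyc_gen Z) %% ('X^n - 1)).
    by rewrite -ch modp_small ?rVpolyK // szXn1 ltnS size_poly.
  have {1}-> : h = \sum_(j < n) h`_j *: 'X^j.
    rewrite -poly_def; apply/polyP => j; rewrite coef_poly.
    by case: ltnP => // nj; rewrite nth_default // (leq_trans szh).
  rewrite mulr_suml (big_morph _ (@modpD _ _) (mod0p _)) linear_sum.
  by apply: eq_bigr => j _; rewrite -scalerAl modpZl linearZ.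
apply: memv_suml => j _; apply: memvZ; apply: memv_span.
by apply/mapP; exists (val j); rewrite // mem_iota /= add0n.
Qed.

Lemma wt_leq c : (wt c <= n)%N.
Proof. by rewrite -[leqRHS](card_ord n) max_card. Qed.

Lemma prim_root_pow_inj (beta : F) : n.-primitive_root beta ->
  injective (fun j : 'I_n => beta ^+ j).
Proof.
move=> pb j k /eqP; rewrite (eq_prim_root_expr pb) !modn_small // => /eqP.
exact: val_inj.
Qed.

(** Both inequalities count conditions: evaluations on [Z] cut the code out of the full space, and
    evaluations at the remaining roots of unity cut it down to zero. *)
Lemma cyclic_code_dim Z (alpha : F) : n.-primitive_root alpha ->
  (forall z, z \in Z -> z ^+ n = 1) -> (\dim (cyclic_code n Z) + #|Z|)%N = n.
Proof.
move=> pa Zn; have n0 := prim_order_gt0 pa.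
have powI := prim_root_pow_inj _ pa.
pose R := [set alpha ^+ (j : 'I_n) | j in 'I_n].
have ZR : Z \subset R.
  by apply/subsetP => z /Zn/(prim_rootP pa)[j ->]; apply: imset_f.
have cR : #|R| = n by rewrite card_imset // card_ord.
apply/eqP; rewrite eqn_leq; apply/andP; split.
  rewrite -[leqRHS]cR -(cardsID Z R) (setIidPr ZR) addnC leq_add2l.
  have := @dimv_le_add_card F (fun z => \col_j z ^+ j) (R :\: Z) (cyclic_code n Z) 0%VS.
  rewrite dimv0; apply => c /(cyclic_codeP _ _ Zn n0) cZ cR0.
  rewrite memv0; apply/negPn/negP => /rV0Pn[j cj].
  (* A non-zero word vanishing at all [n] roots of unity would have weight above [n]. *)
  suff : (n < wt c)%N by rewrite ltnNge wt_leq.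
  apply: (card_support_gt_of_moments _ _ _ _ _ j powI _ cj) => k kn.
  have : (rVpoly c).[alpha ^+ k] = 0.
    have [/cZ//|kZ] := boolP (alpha ^+ k \in Z).
    apply/eqP; rewrite -mulmx_powers_eq0; apply/eqP/cR0; rewrite inE kZ.
    by apply/imsetP; exists (Ordinal kn).
  rewrite horner_rVpoly_sum => {2}<-; apply: eq_bigr => l _.
  by rewrite -!exprM mulnC.
have := @dimv_le_add_card F (fun z => \col_j z ^+ j) Z fullv (cyclic_code n Z).
rewrite dimvf /dim /= mul1n; apply => c _ cZ; apply/(cyclic_codeP _ _ Zn n0).
by move=> z /cZ/eqP; rewrite mulmx_powers_eq0 => /eqP.
Qed.

(** * Minimum distance as a minimum of weights *)

Lemma mindist_geq (P : pred 'rV[F]_n) d : (d <= n.+1)%N ->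
  (forall c, P c -> c != 0 -> (d <= wt c)%N) -> (d <= mindist P)%N.
Proof.
move=> dn Pd; rewrite /mindist -minEnat -leEnat.
by apply: Order.POrderTheory.le_bigmin => // c /andP[]; apply: Pd.
Qed.

Lemma mindist_leq_wt (P : pred 'rV[F]_n) c : P c -> c != 0 -> (mindist P <= wt c)%N.
Proof.
move=> Pc c0; rewrite /mindist -minEnat -leEnat; apply: Order.TotalTheory.bigmin_le_cond.
by rewrite Pc.
Qed.

Lemma mindist_attained (P : pred 'rV[F]_n) c : P c -> c != 0 ->
  exists x, [/\ P x, x != 0 & wt x = mindist P].
Proof.
move=> Pc c0; have [||x /andP[Px x0] xE] := @Order.TotalTheory.eq_bigmin _ nat
  _ n.+1 c [pred x | P x && (x != 0)] (@wt F n).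
- by rewrite /= Pc.
(* The default [n.+1] exceeds every weight, so the minimum comes from a word. *)
- by move=> x _; apply: leqW; apply: wt_leq.
- by exists x; split=> //; rewrite -xE minEnat.
Qed.

(** * Shortening and the Singleton-like bound *)

Lemma punct_mindist_leq_wt_on C (S : {set 'I_n}) c : c \in C ->
  wt_on S c != 0%N -> (punct_mindist C S <= wt_on S c)%N.
Proof.
move=> cC c0; rewrite /punct_mindist -minEnat -leEnat.
by apply: Order.TotalTheory.bigmin_le_cond; rewrite cC.
Qed.

(** The shortening of [C] at [T], but kept in length [n]: the 0/1 diagonal matrix projects onto the
    coordinates in [T]. *)
Definition shorten C (T : {set 'I_n}) : {vspace 'rV[F]_n} :=
  (C :&: lker (linfun (mulmxr (diag_mx (\row_i ((i \in T)%:R : F))))))%VS.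

Lemma shortenP C (T : {set 'I_n}) c :
  reflect (c \in C /\ forall i, i \in T -> c 0 i = 0) (c \in shorten C T).
Proof.
apply: (iffP memv_capP) => -[cC]; rewrite memv_ker lfunE /= => cT; split=> //.
  move=> i iT; move/eqP/rowP/(_ i): cT; rewrite mul_mx_diag !mxE.
  by rewrite iT mulr1.
apply/eqP/rowP => i; rewrite mul_mx_diag !mxE.
by case: (boolP (i \in T)) => [/cT->|_]; rewrite ?mul0r ?mulr0.
Qed.

Lemma dim_shortenU C (T U : {set 'I_n}) :
  (\dim (shorten C T) <= \dim (shorten C (T :|: U)) + #|U|)%N.
Proof.
apply: (@dimv_le_add_card _ (fun i => delta_mx i 0)) => c /shortenP[cC cT] cU.
apply/shortenP; split=> // i /setUP[/cT//|/cU].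
by rewrite -colE => /matrixP/(_ 0 0); rewrite !mxE.
Qed.

Lemma dim_shorten_le C (T : {set 'I_n}) : (\dim (shorten C T) <= #|~: T|)%N.
Proof.
have := dim_shortenU C T (~: T); rewrite setUCr.
suff -> : shorten C setT = 0%VS by rewrite dimv0.
apply/eqP; rewrite -subv0; apply/subvP => c /shortenP[_ c0].
by rewrite memv0; apply/eqP/rowP => i; rewrite c0 ?mxE.
Qed.

Lemma dimv_gt0_nonzero V : (0 < \dim V)%N -> exists2 c, c \in V & c != 0.
Proof.
by move=> V0; exists (vpick V); rewrite ?memv_pick // vpick0 -dimv_eq0 -lt0n.
Qed.

Lemma subset_of_card (I : finType) (X : {set I}) k : (k <= #|X|)%N ->
  exists2 Y : {set I}, Y \subset X & #|Y| = k.
Proof.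
case/card_geqP => s [us <- sX]; exists [set i in s].
  by apply/subsetP => i; rewrite inE => /sX.
by rewrite cardsE; apply/card_uniqP.
Qed.

(* Adjoining a repair group meeting the support of a shortened codeword costs
   at most [#|S :\: T| - delta + 1] dimensions: vanishing on all but [delta - 1]
   of the new coordinates already forces vanishing on the group. *)
Lemma shorten_repair_group C r delta (i : 'I_n) (T : {set 'I_n}) c :
  (0 < delta)%N -> has_locality C r delta i -> c \in shorten C T -> c 0 i != 0 ->
  exists T' : {set 'I_n},
    (#|T| + \dim (shorten C T) + delta.-1 <= #|T'| + \dim (shorten C T'))%N /\
    (\dim (shorten C T) <= \dim (shorten C T') + r)%N.
Proof.
move=> d0 [S [iS Sr Sd]] /shortenP[cC cT] ci.
(* [c] vanishes on [T] but not at [i], so its weight on [S], at least [delta], is carried by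
   [S :\: T]. *)
have dW : (delta <= #|S :\: T|)%N.
  have cS : wt_on S c != 0%N.
    by rewrite -lt0n; apply/card_gt0P; exists i; rewrite !inE iS.
  apply: leq_trans Sd _; apply: leq_trans (punct_mindist_leq_wt_on _ _ _ cC cS) _.
  apply/subset_leq_card/subsetP => j; rewrite !inE => /andP[-> cj].
  by rewrite andbT; apply: contra cj => /cT ->.
have [X XW cX] := subset_of_card _ _ _ (leq_trans (leq_pred _) dW).
exists (T :|: S).
have sub : (shorten C (T :|: (S :\: T :\: X)) <= shorten C (T :|: S))%VS.
  apply/subvP => x /shortenP[xC xT]; apply/shortenP; split=> //.
  have wx : wt_on S x = 0%N.
    apply/eqP; apply: contraT => x0.
    have := leq_trans Sd (punct_mindist_leq_wt_on _ _ _ xC x0).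
    suff : (wt_on S x <= #|X|)%N by rewrite cX; lia.
    apply/subset_leq_card/subsetP => j; rewrite inE => /andP[jS].
    apply: contraR => jX; rewrite xT // !inE jX jS andbT.
    by case: (j \in T).
  move=> j /setUP[jT|jS]; first by rewrite xT // inE jT.
  apply/eqP; apply: contraT => xj.
  move/eqP: wx; rewrite cards_eq0 => /eqP/setP/(_ j).
  by rewrite !inE jS xj.
have /(leq_trans)/(_ (leq_add (dimvS sub) (leqnn _))) := dim_shortenU C T (S :\: T :\: X).
have := cardsID X (S :\: T); rewrite (setIidPr XW) cX.
have -> : #|T :|: S| = (#|T| + #|S :\: T|)%N.
  rewrite -(cardsID T (T :|: S)) setIUl setIid setDUl setDv set0U.
  by congr (#|pred_of_set _| + _)%N; apply/setUidPl/subsetIr.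
have : (#|S :\: T| <= #|S|)%N by rewrite subset_leq_card // subsetDl.
move: (\dim _) (\dim _) #|S :\: T :\: X| #|S :\: T| #|S| #|T| Sr dW => a1 a2 a3 a4 a5 a6.
by clear -d0; lia.
Qed.

(** Repair groups are adjoined one at a time: as long as fewer than [\dim C] dimensions can have
    been lost, a non-zero shortened codeword remains, and any coordinate of its support supplies the
    next group. *)
Lemma shorten_iter C r delta j : is_LRC C r delta -> (j * r < \dim C)%N ->
  exists T : {set 'I_n},
    (\dim C + j * delta.-1 <= #|T| + \dim (shorten C T))%N /\
    (\dim C <= \dim (shorten C T) + j * r)%N.
Proof.
move=> [r0 d2 loc]; elim: j => [_|j IHj jr].
  exists set0; suff -> : shorten C set0 = C by rewrite cards0 !addn0.
  apply/vspaceP => c; apply/shortenP/idP => [[]//|cC]; split=> // i.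
  by rewrite inE.
have [|T [T1 T2]] := IHj; first by apply: leq_ltn_trans jr; rewrite mulSn leq_addl.
have /dimv_gt0_nonzero[c cT /rV0Pn[i ci]] : (0 < \dim (shorten C T))%N.
  rewrite lt0n; apply/eqP => K0; move: T2; rewrite K0 add0n leqNgt.
  by rewrite (leq_ltn_trans _ jr) // mulSn leq_addl.
have [T' [T'1 T'2]] := shorten_repair_group _ _ _ _ _ _ (ltnW d2) (loc i) cT ci.
exists T'; move: T1 T2 T'1 T'2; rewrite !mulSn.
move: (\dim _) (\dim _) (\dim _) #|T| #|T'| (j * r)%N (j * _)%N => a1 a2 a3 a4 a5 a6 a7.
by clear; lia.
Qed.

Lemma LRC_singleton_bound C r delta : is_LRC C r delta -> (0 < \dim C)%N ->
  (mindist (fun c => c \in C) + \dim C + (ceil_div (\dim C) r).-1 * delta.-1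
     <= n.+1)%N.
Proof.
move=> lrc C0; have [r0 _ _] := lrc.
(* [ceil_div (\dim C) r * r] is at most [\dim C + r.-1], so one group fewer stays strictly below
   [\dim C]. *)
have jr : ((ceil_div (\dim C) r).-1 * r < \dim C)%N.
  have := leq_divM (\dim C + r.-1) r; rewrite -/(ceil_div _ _).
  case: (ceil_div _ _) => [|q] /=; first by rewrite mul0n.
  by rewrite mulSn; move: (\dim _) (q * r)%N => a1 a2; clear -r0; lia.
have [T [T1 T2]] := shorten_iter _ _ _ _ lrc jr.
have K0 : (0 < \dim (shorten C T))%N.
  rewrite lt0n; apply/eqP => K0; move: T2; rewrite K0 add0n leqNgt.
  by rewrite jr.
have KT := dim_shorten_le C T.
(* [U] imposes one condition less than the remaining dimension, so a non-zero word survives with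
   support outside [T :|: U]. *)
have [U UT cU] := subset_of_card _ _ _ (leq_trans (leq_pred _) KT).
have /dimv_gt0_nonzero[c /shortenP[cC cTU] c0] : (0 < \dim (shorten C (T :|: U)))%N.
  have := dim_shortenU C T U; rewrite cU.
  by move: (\dim _) (\dim _) K0 => a1 a2; clear; lia.
have cw : (wt c <= #|~: T :\: U|)%N.
  apply/subset_leq_card/subsetP => i; rewrite !inE; apply: contraR => iTU.
  by rewrite cTU // inE; case: (i \in T) iTU => //=; rewrite andbT negbK.
have dc := mindist_leq_wt (fun c => c \in C) c cC c0.
have := cardsID U (~: T); rewrite (setIidPr UT) cU.
have := cardsC T; rewrite card_ord.
move: dc cw K0 T1; move: (_ * _)%N (mindist _) (wt c).
move: (\dim _) (\dim _) #|~: T :\: U| #|~: T| #|T| => a1 a2 a3 a4 a5 a6 a7 a8.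
by clear; lia.
Qed.

(** * Dual codes and locality *)

Lemma dual_codeP C x :
  reflect (forall c, c \in C -> \sum_j x 0 j * c 0 j = 0) (dual_code C x).
Proof.
apply: (iffP forallP) => xC c.
  move=> cC; have /implyP/(_ cC)/eqP/matrixP/(_ 0 0) := xC c.
  by rewrite !mxE => h; rewrite -[RHS]h; apply: eq_bigr => j _; rewrite mxE.
apply/implyP => /xC h; apply/eqP/matrixP => a b; rewrite !ord1 !mxE -[RHS]h.
by apply: eq_bigr => j _; rewrite mxE.
Qed.

(* Twisting a word of [C_AB] by the powers of [w] gives a word of [C_A]. *)
Lemma dual_code_twist (A B : {set F}) x c w : (0 < n)%N ->
  (forall z, z \in A -> z ^+ n = 1) -> (forall z, z \in B -> z ^+ n = 1) ->
  dual_code (cyclic_code n A) x -> c \in cyclic_code n (setprod A B) -> w \in B ->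
  \sum_j x 0 j * c 0 j * w ^+ j = 0.
Proof.
move=> n0 An Bn /dual_codeP xA cAB wB.
have ABn z : z \in setprod A B -> z ^+ n = 1.
  by case/imset2P => a b aA bB ->; rewrite exprMn An // Bn // mulr1.
have := xA (\row_j (c 0 j * w ^+ j)).
rewrite (eq_bigr (fun j => x 0 j * c 0 j * w ^+ j)) => [|j _]; last by rewrite mxE mulrA.
apply; apply/cyclic_codeP => // z zA.
have /(cyclic_codeP _ _ ABn n0)/(_ (z * w)) := cAB.
rewrite !horner_rVpoly_sum => h; rewrite -[RHS]h; last exact: imset2_f.
by apply: eq_bigr => j _; rewrite mxE exprMn mulrA mulrAC.
Qed.

Lemma sum_powers_eq0 (u : F) : u ^+ n = 1 -> u != 1 -> \sum_(j < n) u ^+ j = 0.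
Proof.
move=> un u1; have /eqP := subrX1 u n.
by rewrite un subrr eq_sym mulf_eq0 subr_eq0 (negPf u1) => /eqP.
Qed.

(* The dual code vanishes at the inverses of the roots of unity outside [A]. *)
Lemma dual_mindist_geq (A : {set F}) (beta gamma : F) d :
  n.-primitive_root beta -> (forall z, z \in A -> z ^+ n = 1) -> gamma ^+ n = 1 ->
  (d <= n)%N -> (forall j, (j < d)%N -> gamma * beta ^+ j \notin A) ->
  (d < mindist (dual_code (cyclic_code n A)))%N.
Proof.
move=> pb An gn dn gA; have n0 := prim_order_gt0 pb.
have bn := prim_expr_order pb.
have g0 : gamma != 0 by apply: contra_eq_neq gn => ->; rewrite expr0n eqn0Ngt n0 eq_sym oner_neq0.
apply: mindist_geq => // x /dual_codeP xA /rV0Pn[k xk].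
have -> : wt x = #|[set j | x 0 j * gamma ^- j != 0%R]|.
  congr #|pred_of_set _|; apply/setP => j; rewrite !inE mulf_eq0 invr_eq0 expf_eq0.
  by rewrite (negPf g0) andbF orbF.
apply: (@card_support_gt_of_moments _ _ (fun j : 'I_n => beta^-1 ^+ j) _ _ k).
- by move=> j l; rewrite !exprVn => /invr_inj/(prim_root_pow_inj _ pb).
(* The row of powers of [y] is in [C_A]: at [z] in [A] it evaluates to a geometric sum of ratio
   [y * z], which is not 1 because [gamma * beta ^+ j] is outside [A]. *)
- move=> j jd; pose y := (gamma * beta ^+ j)^-1.
  have yn : y ^+ n = 1 by rewrite exprVn exprMn gn -exprM mulnC exprM bn expr1n mulr1 invr1.
  have := xA (\row_k y ^+ k).
  rewrite (eq_bigr (fun k : 'I_n => x 0 k * gamma ^- k * beta^-1 ^+ k ^+ j)) => [|l _].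
    apply; apply/cyclic_codeP => // z zA; rewrite horner_rVpoly_sum.
    under eq_bigr => l _ do rewrite mxE -exprMn.
    apply: sum_powers_eq0; first by rewrite exprMn yn An // mulr1.
    apply: contra (gA j jd) => /eqP yz.
    suff -> : gamma * beta ^+ j = z by [].
    by rewrite -[LHS]mulr1 -yz /y mulVKf // mulf_neq0 // expf_neq0 // (prim_root_eq0 pb) -lt0n.
  by rewrite mxE /y invfM exprMn mulrA !exprVn -!exprM mulnC.
- by rewrite mulf_neq0 // invr_neq0 // expf_neq0.
Qed.

Lemma dual_support_punct_mindist (A : {set F}) (beta : F) delta x :
  n.-primitive_root beta -> (forall z, z \in A -> z ^+ n = 1) -> (0 < delta)%N ->
  dual_code (cyclic_code n A) x -> (delta <= wt x)%N ->
  (delta <= punct_mindist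
     (cyclic_code n (setprod A [set beta ^+ (j : 'I_delta.-1) | j in 'I_delta.-1]))
     [set j | x 0%R j != 0%R])%N.
Proof.
move=> pb An d0 xA dx; have n0 := prim_order_gt0 pb.
rewrite /punct_mindist -minEnat -leEnat.
(* The bound on [wt x] settles the default value, the size of the support plus one. *)
apply: Order.POrderTheory.le_bigmin => [|c /andP[cAB]]; first exact: leqW.
rewrite -lt0n => /card_gt0P[k]; rewrite !inE => /andP[xk ck].
rewrite leEnat; have -> : wt_on [set j | x 0 j != 0%R] c = #|[set j | x 0 j * c 0 j != 0%R]|.
  by congr #|pred_of_set _|; apply/setP => j; rewrite !inE mulf_eq0 negb_or.
rewrite -{1}(prednK d0).
apply: (@card_support_gt_of_moments _ _ (fun j : 'I_n => beta ^+ j) _ _ k).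
- exact: prim_root_pow_inj.
- move=> j jd; under eq_bigr => l _ do rewrite -exprM mulnC exprM.
  apply: (dual_code_twist _ _ _ _ _ n0 An _ xA cAB); last first.
    by apply/imsetP; exists (Ordinal jd).
  by move=> _ /imsetP[l _ ->]; rewrite -exprM mulnC exprM (prim_expr_order pb) expr1n.
- by rewrite mulf_neq0.
Qed.

End LinearCodes.

(** Move the shift from [x] to the codeword: shifting a codeword back by [a] changes its value at a
    root [z] only by a power of [z]. Length [n.+1] gives the indices modular addition. *)
Lemma dual_cyclic_shift (F : finFieldType) (n : nat) (A : {set F}) (a : 'I_n.+1)
    (x : 'rV[F]_n.+1) :
  (forall z, z \in A -> z ^+ n.+1 = 1) -> dual_code (cyclic_code n.+1 A) x ->
  dual_code (cyclic_code n.+1 A) (\row_j x 0 (j - a)).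
Proof.
move=> An /dual_codeP xA; apply/dual_codeP => c cA.
have addI : injective (fun j : 'I_n.+1 => j + a) by exact: addIr.
have /xA : (\row_j c 0 (j + a)) \in cyclic_code n.+1 A.
  apply/cyclic_codeP => // z zA.
  move/cyclic_codeP: cA => /(_ An isT z zA); rewrite !horner_rVpoly_sum => h.
  have z0 : z != 0 by apply: contra_eq_neq (An z zA) => ->; rewrite expr0n eq_sym oner_neq0.
  apply: (mulIf (expf_neq0 a z0)); rewrite mul0r -[RHS]h [RHS](reindex_inj addI) mulr_suml.
  apply: eq_bigr => j _; rewrite mxE -mulrA -exprD; congr (_ * _).
  by rewrite -[LHS](expr_mod _ (An z zA)).
move=> h; rewrite -[RHS]h (reindex_inj addI).
by apply: eq_bigr => j _; rewrite !mxE addrK.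
Qed.

Lemma cyclic_product_LRC (F : finFieldType) (n : nat) (A : {set F}) (beta z0 : F)
    (delta : nat) :
  n.-primitive_root beta -> (forall z, z \in A -> z ^+ n = 1) -> z0 \in A ->
  (2 <= delta)%N -> (delta <= mindist (dual_code (cyclic_code n A)))%N ->
  is_LRC (cyclic_code n (setprod A [set beta ^+ (j : 'I_delta.-1) | j in 'I_delta.-1]))
    ((mindist (dual_code (cyclic_code n A))).+1 - delta) delta.
Proof.
case: n => [/prim_order_gt0//|n] pb An z0A d2 dA; split=> //.
  by rewrite subn_gt0.
have z0n := An z0 z0A.
have [x [xA /rV0Pn[k xk] wx]] : exists x : 'rV[F]_n.+1,
    [/\ dual_code (cyclic_code n.+1 A) x, x != 0
      & wt x = mindist (dual_code (cyclic_code n.+1 A))].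
  (* Evaluation at [z0] provides a non-zero dual word. *)
  apply: (mindist_attained _ _ _ (\row_j z0 ^+ j)).
    apply/dual_codeP => c /(cyclic_codeP _ _ _ _ An isT)/(_ z0 z0A).
    rewrite horner_rVpoly_sum => h; rewrite -[RHS]h.
    by apply: eq_bigr => j _; rewrite mxE mulrC.
  by apply/rV0Pn; exists ord0; rewrite mxE oner_neq0.
(* The shift by [i - k] carries the support position [k] of [x] to [i]. *)
move=> i; pose x' := \row_j x 0 (j - (i - k)).
have x'A : dual_code (cyclic_code n.+1 A) x' by exact: dual_cyclic_shift.
have wx' : wt x' = wt x.
  rewrite /wt -[RHS](card_imset _ (addIr (i - k))).
  congr #|pred_of_set _|; apply/setP => j; rewrite inE mxE.
  apply/idP/imsetP => [xj|[l]]; first by exists (j - (i - k)); rewrite ?inE ?subrK.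
  by rewrite inE => xl ->; rewrite addrK.
exists [set j | x' 0 j != 0%R]; split.
- by rewrite inE mxE opprB addrC subrK.
- by rewrite -/(wt x') wx' wx; lia.
- by apply: dual_support_punct_mindist => //; rewrite ?wx' ?wx // ltnW.
Qed.

(** * Counting the zeros *)

Lemma card_runs (F : finFieldType) (f : nat -> F) (D : {set F})
    (n delta s m : nat) (i : nat -> nat) :
  (forall e e', (e < n)%N -> (e' < n)%N -> f e = f e' -> e = e') ->
  (forall z, z \in D <-> exists2 e, f e = z &
     (e < m + delta - 2)%N \/ exists2 l, (l < s)%N & (i l.+1 <= e < i l.+1 + delta.-1)%N) ->
  (2 <= delta)%N -> (0 < m)%N ->
  (forall l, (l < s)%N -> (m - 1 + delta <= i l.+1)%N) ->
  (forall l, (l < s)%N -> (i l.+1 + delta <= n)%N) -> (m + delta <= n)%N ->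
  (forall l l', (l < l')%N -> (l' < s)%N -> (i l.+1 + delta <= i l'.+1)%N) ->
  #|D| = (m + delta - 2 + s * delta.-1)%N.
Proof.
move=> fI DE d2 m0 lb ub mn gap.
pose X := [set f (e : 'I_(m + delta - 2)) | e in 'I_(m + delta - 2)].
pose Y := [set f (i p.1.+1 + p.2)%N | p : 'I_s * 'I_delta.-1].
have -> : D = X :|: Y.
  apply/setP => z; apply/idP/idP => [/DE[e <-]|].
    case=> [em|[l ls le]]; rewrite inE; apply/orP; [left|right].
      by apply/imsetP; exists (Ordinal em).
    have ed : (e - i l.+1 < delta.-1)%N by lia.
    apply/imsetP; exists (Ordinal ls, Ordinal ed); rewrite ?inE //=.
    by congr f; lia.
  move=> zXY; apply/DE; case/setUP: zXY => /imsetP[].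
    by move=> e _ ->; exists e => //; left; exact: ltn_ord.
  move=> [l j] _ ->; exists (i l.+1 + j)%N => //=; right; exists l; first exact: ltn_ord.
  by have := ltn_ord j; lia.
rewrite cardsU (_ : X :&: Y = set0) ?cards0 ?subn0; last first.
  apply/setP => z; rewrite !inE; apply/negP => /andP[/imsetP[e _ ->] /imsetP[[l j] _ /=]].
  have := ltn_ord e; have := ltn_ord j; have := lb _ (ltn_ord l).
  have := ub _ (ltn_ord l) => h1 h2 h3 h4 /fI h.
  by have := h ltac:(lia) ltac:(lia); lia.
congr (_ + _)%N.
  rewrite card_imset ?card_ord // => e e' /fI h; apply: val_inj.
  by have := ltn_ord e; have := ltn_ord e' => h1 h2; apply: h; lia.
rewrite card_imset; first by rewrite card_prod !card_ord.
move=> [l j] [l' j'] /= /fI h.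
have lj := ltn_ord j; have lj' := ltn_ord j'.
have ul := ub _ (ltn_ord l); have ul' := ub _ (ltn_ord l').
have {}h : (i l.+1 + j = i l'.+1 + j')%N by apply: h; lia.
(* Starting points of different runs are at least [delta] apart, while each run has length
   [delta.-1]. *)
have ll : l = l'.
  apply: val_inj; case: (ltngtP l l') => // ll.
    by have := gap _ _ ll (ltn_ord l'); lia.
  by have := gap _ _ ll (ltn_ord l); lia.
by rewrite ll in h *; congr pair; apply: val_inj; rewrite /=; lia.
Qed.

(** * Zeros, locality, dimension and distance of [C_AB] *)

Theorem theorem4p1 (F : finFieldType) (n : nat) (alpha : F)
  (hn : (n %| #|F|.-1)%N) (halpha : n.-primitive_root alpha)
  (delta b s m t : nat) (i : nat -> nat)
  (hdelta : (2 <= delta)%N) (hb : (1 <= b)%N) (hs : (1 <= s)%N) (hm : (1 <= m)%N)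
  (hbn : coprime b n) (ht : (t < n)%N)
  (hi1 : (m - 1 + delta <= i 1)%N) (his : (i s <= n - delta)%N)
  (hgap : forall l : nat, (1 <= l < s)%N -> (i l + delta <= i l.+1)%N) :
  let A : {set F} :=
    [set alpha ^+ (t + j * b) | j : 'I_m] :|: [set alpha ^+ (t + i l.+1 * b) | l : 'I_s] in
  let B : {set F} := [set alpha ^+ (j * b) | j : 'I_delta.-1] in
  let C := cyclic_code n (setprod A B) in
  let dA := mindist (dual_code (cyclic_code n A)) in
  let r := (dA.+1 - delta)%N in
  let k := \dim C in
  [/\ is_LRC C r delta,
      k%:Z = n%:Z - m%:Z + 1 - (s%:Z + 1) * (delta%:Z - 1)
    & ceil_div k r = s.+1 ->
      optimal_LRC C r delta /\ mindist (fun c => c \in C) = (m + delta - 1)%N].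
Proof.
move=> A B C dA r k.
have n0 := prim_order_gt0 halpha.
pose beta := alpha ^+ b; pose gamma := alpha ^+ t; pose f e := gamma * beta ^+ e.
have pb : n.-primitive_root beta by rewrite /beta prim_root_exp_coprime.
have fE e : alpha ^+ (t + e * b) = f e by rewrite exprD mulnC exprM.
have an e : (alpha ^+ e) ^+ n = 1.
  by rewrite -exprM mulnC exprM (prim_expr_order halpha) expr1n.
have fn e : f e ^+ n = 1 by rewrite -fE an.
have g0 : gamma != 0.
  by rewrite expf_neq0 // (prim_root_eq0 halpha) eqn0Ngt n0.
have fI e e' : (e < n)%N -> (e' < n)%N -> f e = f e' -> e = e'.
  move=> en e'n /(mulfI g0)/eqP.
  by rewrite (eq_prim_root_expr pb) !modn_small // => /eqP.
have gap l l' : (l < l')%N -> (l' < s)%N -> (i l.+1 + delta <= i l'.+1)%N.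
  elim: l' => // l' IH; rewrite ltnS leq_eqVlt => /orP[/eqP->|ll'] l's.
    by apply: hgap.
  by have := IH ll' (ltnW l's); have := hgap l'.+1 ltac:(lia); lia.
have lb l : (l < s)%N -> (m - 1 + delta <= i l.+1)%N.
  by case: l => // l ls; have := gap 0%N l.+1 isT ls; lia.
have is_s : i s = i s.-1.+1 by rewrite prednK.
have s1 : (s.-1 < s)%N by lia.
(* As [i s] is positive, the truncated [n - delta] in [his] is a genuine difference. *)
have ub l : (l < s)%N -> (i l.+1 + delta <= n)%N.
  move=> ls; have := lb _ s1; rewrite -is_s.
  have [/gap/(_ s1)|] := ltnP l s.-1; first by rewrite -is_s; lia.
  by move=> sl; have -> : l = s.-1 by [lia]; rewrite -is_s; lia.
have mn : (m + delta <= n)%N by have := ub _ s1; have := lb _ s1; lia.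
have An z : z \in A -> z ^+ n = 1.
  by case/setUP => /imsetP[j _ ->]; rewrite fE fn.
have BE : B = [set beta ^+ (j : 'I_delta.-1) | j in 'I_delta.-1].
  by apply: eq_imset => j; rewrite mulnC exprM.
have AP z : z \in A <->
    exists2 e, f e = z & (e < m)%N \/ exists2 l, (l < s)%N & e = i l.+1.
  split=> [/setUP[]/imsetP[j _ ->]|[e <-]].
  - by exists j => //; left; exact: ltn_ord.
  - by exists (i j.+1) => //; right; exists j => //; exact: ltn_ord.
  case=> [em|[l ls ->]]; apply/setUP; [left|right]; apply/imsetP.
    by exists (Ordinal em).
  by exists (Ordinal ls).
(* Adding exponents up to [delta - 2] extends the initial block of [A] to length [m + delta - 2] and
   each isolated exponent to a run of length [delta.-1]. *)
have ABP z : z \in setprod A B <-> exists2 e, f e = z &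
    (e < m + delta - 2)%N \/
    exists2 l, (l < s)%N & (i l.+1 <= e < i l.+1 + delta.-1)%N.
  rewrite BE; split=> [/imset2P[a c /AP[e <- eA] /imsetP[j _ ->] ->]|[e <- eAB]].
    exists (e + j)%N; first by rewrite /f exprD mulrA.
    have := ltn_ord j; case: eA => [em jd|[l ls ->] jd]; [left; lia|right].
    by exists l => //; lia.
  suff [e1 [e2 [-> e1A e2d]]] : exists e1 e2, [/\ e = (e1 + e2)%N,
      (e1 < m)%N \/ (exists2 l, (l < s)%N & e1 = i l.+1) & (e2 < delta.-1)%N].
    rewrite /f exprD mulrA; apply: imset2_f; first by apply/AP; exists e1.
    by apply/imsetP; exists (Ordinal e2d).
  case: eAB => [em|[l ls le]].
    (* Cap the first summand at [m.-1], the last exponent of the initial block; the excess is below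
       [delta.-1]. *)
    by exists (minn e m.-1), (e - m.-1)%N; split; [lia|left; lia|lia].
  by exists (i l.+1), (e - i l.+1)%N; split; [lia|right; exists l|lia].
have ABn z : z \in setprod A B -> z ^+ n = 1 by case/ABP=> e <- _.
have cAB : #|setprod A B| = (m + delta - 2 + s * delta.-1)%N.
  exact: (card_runs _ _ _ _ _ _ _ _ fI ABP).
have kE : (k + (m + delta - 2 + s * delta.-1))%N = n.
  by rewrite -cAB (cyclic_code_dim _ _ _ _ halpha ABn).
(* The [delta.-1] exponents following [i s] lie beyond every exponent of [A] and still below [n]. *)
have ddA : (delta <= dA)%N.
  rewrite -(prednK (ltnW hdelta)).
  apply: (dual_mindist_geq _ _ _ _ (f (i s).+1) _ pb An (fn _)); first by lia.
  move=> j jd; rewrite /f -mulrA -exprD -/(f _).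
  apply/negP => /AP[e /fI h eA].
  have := ub _ s1; rewrite -is_s => us; have := lb _ s1; rewrite -is_s => ls.
  have {h} eE : e = ((i s).+1 + j)%N.
    by apply: h; [case: eA => [|[l /ub + ->]]|]; lia.
  case: eA => [|[l lls el]]; first by lia.
  have [/gap/(_ s1)|sl] := ltnP l s.-1; first by rewrite -is_s; lia.
  by move: el; have -> : l = s.-1 by [lia]; rewrite -is_s; lia.
have lrc : is_LRC C r delta.
  rewrite /C BE; apply: (cyclic_product_LRC _ _ _ _ (f 0%N)) => //.
  by apply/AP; exists 0%N => //; left.
have kZ : k%:Z = n%:Z - m%:Z + 1 - (s%:Z + 1) * (delta%:Z - 1).
  have -> : delta%:Z - 1 = delta.-1%:Z by lia.
  by rewrite mulrDl mul1r -PoszM; lia.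
split=> // ceilE; have [r0 _ _] := lrc.
(* Dimension zero would make the ceiling 0 instead of [s.+1]. *)
have k0 : (0 < k)%N.
  rewrite lt0n; apply/eqP => k0; move: ceilE.
  by rewrite k0 /ceil_div add0n divn_small // prednK.
have dE : mindist (fun c => c \in C) = (m + delta - 1)%N.
  apply/eqP; rewrite eqn_leq; apply/andP; split.
    (* With ceiling [s.+1] the bound reads [d + k + s * delta.-1 <= n.+1], and [kE] turns it into
       [d <= m + delta - 1]. *)
    have := LRC_singleton_bound _ _ _ _ _ lrc k0; rewrite -/k ceilE /=.
    by move: (s * _)%N kE => a1 a2; lia.
  apply: mindist_geq => [|c cC /rV0Pn[j cj]]; first by lia.
  have -> : (m + delta - 1 = (m + delta - 2).+1)%N by lia.
  (* Scaling coordinate [l] by [gamma ^+ l] keeps the support and turns the zeros [f e] of the first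
     run into [beta ^+ e], starting at exponent 0. *)
  have -> : wt c = #|[set l | c 0 l * gamma ^+ l != 0%R]|.
    congr #|pred_of_set _|; apply/setP => l.
    by rewrite !inE mulf_eq0 expf_eq0 (negPf g0) andbF orbF.
  apply: (@card_support_gt_of_moments _ _ (fun j : 'I_n => beta ^+ j) _ _ j).
  - exact: prim_root_pow_inj.
  - move=> e em; move/cyclic_codeP: cC => /(_ ABn n0 (f e)).
    rewrite horner_rVpoly_sum => h; rewrite -[RHS]h.
      by apply: eq_bigr => l _; rewrite exprMn mulrA -!exprM [(e * l)%N]mulnC.
    by apply/ABP; exists e => //; left.
  - by rewrite mulf_neq0 // expf_neq0.
split=> //; split=> //; rewrite dE -/k kZ ceilE.
by clear -hdelta hm; lia.
Qed.
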